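(* Let $\lambda,\mu,\nu$ be partitions of the same integer with $\ell(\lambda)\le 4$, $\ell(\mu),\ell(\nu)\le 2$, and $\mu_2\ge\nu_2$. Then $\tilde g_{\mu,\nu,\lambda}\ge g_{\mu,\nu,\lambda}$.
   Context: Partitions are padded with zero parts. The Kronecker coefficient $g_{\mu,\nu,\lambda}$ is defined by $s_\lambda(x_1y_1,x_1y_2,x_2y_1,x_2y_2)=\sum_{\mu,\nu}g_{\mu,\nu,\lambda}\,s_\mu(x_1,x_2)s_\nu(y_1,y_2)$, with $s$ the Schur polynomials. For integers $n,m$, $p_S(n,m)$ is the number of $(x_1,\dots,x_4)\in\mathbb{Z}_{\ge0}^4$ with $x_1+x_3+x_4=n$, $x_2+x_3+2x_4=m$ (zero if $n<0$ or $m<0$). The atomic Kronecker coefficient is $\tilde g_{\mu,\nu,\lambda}:=p_S(\nu_2-\lambda_3-\lambda_4,\ \mu_2+\nu_2-\lambda_2-\lambda_3-2\lambda_4)$; equivalently, it is the coefficient of $x^{\mu_2-\lambda_2-\lambda_4}y^{\nu_2-\lambda_3-\lambda_4}$ in the Laurent expansion of $1/((1-y/x)(1-xy)(1-x)(1-y))$ in the domain $0<|xy|<|y|<|x|<1$. *)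

(* Defs.v *)
From HB Require Import structures.
From mathcomp Require Import all_boot all_order all_algebra.
Set Implicit Arguments. Unset Strict Implicit. Unset Printing Implicit Defensive.
Import Order.TTheory GRing.Theory Num.Theory.

(* A partition is a weakly decreasing sequence of positive integers
   (no trailing zeros); parts are read with padding by zeros: part i = nth 0 _ i
   (0-indexed, so lambda_k = nth 0 lam k.-1). *)
Definition is_partition (lam : seq nat) : bool :=
  sorted geq lam && all (fun x => 0 < x) lam.

Definition part (lam : seq nat) (k : nat) : nat := nth 0 lam k.-1.

Definition seqs_len (k n : nat) : seq (seq nat) :=
  iter k (fun acc => [seq i :: s | i <- iota 0 n, s <- acc]) [:: [::]].

Definition fillings (lam : seq nat) (n : nat) : seq (seq (seq nat)) :=
  foldr (fun k acc => [seq r :: t | r <- seqs_len k n, t <- acc]) [:: [::]] lam.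

Definition is_ssyt (t : seq (seq nat)) : bool :=
  all (fun r => sorted leq r) t &&
  all (fun i => all (fun j => nth 0 (nth [::] t i) j < nth 0 (nth [::] t i.+1) j)
                    (iota 0 (size (nth [::] t i.+1))))
      (iota 0 (size t).-1).

Definition content (n : nat) (t : seq (seq nat)) : seq nat :=
  [seq count_mem i (flatten t) | i <- iota 0 n].

(* Coefficient of z_1^{alpha_1} ... z_n^{alpha_n} in the Schur polynomial
   s_lam(z_1,...,z_n) = sum over SSYT T of shape lam with entries in [n] of z^T,
   where n = size alpha (entries i-1 stand for variable z_i). *)
Definition schur_coef (lam alpha : seq nat) : nat :=
  count (fun t => is_ssyt t && (content (size alpha) t == alpha))
        (fillings lam (size alpha)).

(* Coefficient of x1^a1 x2^a2 y1^b1 y2^b2 in s_lam(x1y1, x1y2, x2y1, x2y2):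
   the monomial z1^c1 z2^c2 z3^c3 z4^c4 becomes
   x1^(c1+c2) x2^(c3+c4) y1^(c1+c3) y2^(c2+c4). *)
Definition schur_sub_coef (lam : seq nat) (a1 a2 b1 b2 : nat) : nat :=
  \sum_(c1 < a1.+1) \sum_(c2 < a1.+1) \sum_(c3 < a2.+1) \sum_(c4 < a2.+1)
    (if [&& c1 + c2 == a1, c3 + c4 == a2, c1 + c3 == b1 & c2 + c4 == b2]
     then schur_coef lam [:: (c1 : nat); (c2 : nat); (c3 : nat); (c4 : nat)]
     else 0)%N.

Definition parts2 (m : nat) : seq (seq nat) :=
  [seq filter (fun x => 0 < x) [:: m - k; k] | k <- iota 0 (m./2).+1].

(* g is the family of Kronecker coefficients: for every partition lam,
   s_lam(x1y1,x1y2,x2y1,x2y2) = sum_{mu,nu} g mu nu lam s_mu(x1,x2) s_nu(y1,y2),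
   compared coefficientwise.  Only mu, nu of length <= 2 and size |lam| can
   contribute (other Schur polynomials vanish in 2 variables or have the wrong
   degree), so the sum ranges over those. *)
Definition kronecker_spec (g : seq nat -> seq nat -> seq nat -> int) : Prop :=
  forall lam, is_partition lam -> forall a1 a2 b1 b2 : nat,
    ((schur_sub_coef lam a1 a2 b1 b2)%:Z =
    \sum_(mu <- parts2 (sumn lam)) \sum_(nu <- parts2 (sumn lam))
      g mu nu lam * (schur_coef mu [:: a1; a2])%:Z * (schur_coef nu [:: b1; b2])%:Z)%R.

Definition pS (n m : int) : nat :=
  match n, m with
  | Posz n', Posz m' =>
      \sum_(x1 < n'.+1) \sum_(x2 < m'.+1) \sum_(x3 < n'.+1) \sum_(x4 < n'.+1)
        ((x1 + x3 + x4 == n') && (x2 + x3 + 2 * x4 == m'))%N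
  | _, _ => 0%N
  end.

Definition atomic_kron (mu nu lam : seq nat) : nat :=
  pS ((part nu 2)%:Z - (part lam 3)%:Z - (part lam 4)%:Z)%R
     ((part mu 2)%:Z + (part nu 2)%:Z - (part lam 2)%:Z - (part lam 3)%:Z
        - 2 * (part lam 4)%:Z)%R.

(* Main.v *)
Require Import Defs.
From HB Require Import structures.
From mathcomp Require Import all_boot all_order all_algebra.
From mathcomp Require Import zify.
Import Order.TTheory GRing.Theory Num.Theory.

(** Semistandard tableaux with entries in four letters are Gelfand-Tsetlin
    patterns with rows [l >= k >= (a1, a2) >= r].  Specialise the variables to
    [1, x, y, xy], with [x] on the second letter.  For fixed [(a1, a2)], the
    coordinates [r, k1, k2, k3] range over independent intervals and the
    x-degree is, up to a constant, the sum of the four interval coordinates;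
    the iterated Clebsch-Gordan rule then turns the difference in the x-degree
    into a count of pairs [(a1, a2), k] satisfying three extra inequalities (the
    highest weights for [x]).  In these inequalities [k1 - a1] is bounded from
    above only, so replacing [a1] by [a1 + 1] lowers the y-degree by one and
    stays among the highest weights unless [a1 = k1].  Hence the difference in
    the y-degree, which is the Kronecker coefficient, is at most the number of
    patterns with [a1 = k1], and the four remaining coordinates [k2 - a2],
    [l3 - k3], [l2 - k2], [l1 - k1] of such a pattern are a point counted by
    [pS]. *)

(** * Clebsch-Gordan decomposition of sums over boxes *)

(* A rectangle is the hook made of its first column and last row, on which
   [i + j] takes each value once, plus a smaller rectangle. *)
Lemma clebsch_gordan (s l : nat) (f : nat -> nat) :
  \sum_(i < s.+1) \sum_(j < l.+1) f (i + j) =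
  \sum_(c < (minn s l).+1) \sum_(i < (s + l - c.*2).+1) f (i + c).
Proof.
elim: l s f => [|l IHl] [|s] f.
- by rewrite !big_ord1.
- rewrite minn0 big_ord1 addn0 subn0; apply: eq_bigr => i _.
  by rewrite big_ord1.
- by rewrite min0n !big_ord1 add0n subn0; apply: eq_bigr => i _; rewrite addnC.
have -> : minn s.+1 l.+1 = (minn s l).+1 by lia.
rewrite [RHS]big_ord_recl /=.
have -> : (s.+1 + l.+1 - 0).+1 = s.+2 + l.+1 by lia.
rewrite big_split_ord /=.
under [LHS]eq_bigr do rewrite big_ord_recl.
rewrite big_split /= -addnA; congr (_ + _).
rewrite big_ord_recr /= addnC; congr (_ + _).
  by apply: eq_bigr => j _; rewrite /= /bump /=; congr f; lia.
under eq_bigr do under eq_bigr do rewrite /bump /= addnCA add1n.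
rewrite (IHl s (fun k => f k.+1)); apply: eq_bigr => c _.
have -> : s.+1 + l.+1 - (bump 0 c).*2 = s + l - c.*2 by rewrite /bump /=; lia.
by apply: eq_bigr => i _; rewrite /bump /= addnCA add1n.
Qed.

(** The sums test [a] against [[o, o + s]] and [[o + 1, o + s + 1]], which differ at their ends
    only. The hypothesis puts [a] at or below the middle of [[o, o + s + 1]], hence away from the
    upper end. *)
Lemma string_diff (s o a : nat) : a.*2 <= o.*2 + s.+1 ->
  \sum_(i < s.+1) (i + o == a) = \sum_(i < s.+1) ((i + o).+1 == a) + (o == a).
Proof.
move=> le_a.
have <- : \sum_(i < s.+2) (i + o == a) = \sum_(i < s.+1) (i + o == a).
  by rewrite big_ord_recr /= (_ : (s.+1 + o == a) = false) ?addn0 //; lia.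
by rewrite big_ord_recl addnC.
Qed.

Lemma clebsch_gordan4 (s l1 l2 l3 : nat) (f : nat -> nat) :
  \sum_(c0 < s.+1) \sum_(c1 < l1.+1) \sum_(c2 < l2.+1) \sum_(c3 < l3.+1)
    f (c0 + c1 + c2 + c3) =
  \sum_(c1 < (minn s l1).+1) \sum_(c2 < (minn (s + l1 - c1.*2) l2).+1)
    \sum_(c3 < (minn (s + l1 - c1.*2 + l2 - c2.*2) l3).+1)
      \sum_(i < (s + l1 - c1.*2 + l2 - c2.*2 + l3 - c3.*2).+1)
        f (i + (c1 + c2 + c3)).
Proof.
rewrite (clebsch_gordan s l1
  (fun x => \sum_(c2 < l2.+1) \sum_(c3 < l3.+1) f (x + c2 + c3))).
apply: eq_bigr => c1 _.
under eq_bigr do under eq_bigr do rewrite addnAC.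
rewrite (clebsch_gordan _ l2 (fun x => \sum_(c3 < l3.+1) f (x + c1 + c3))).
apply: eq_bigr => c2 _.
under eq_bigr do under eq_bigr do rewrite addnAC (addnAC _ c2).
rewrite (clebsch_gordan _ l3 (fun x => f (x + c2 + c1))).
apply: eq_bigr => c3 _; apply: eq_bigr => i _.
by congr f; lia.
Qed.

(** All strings of the decomposition have the same centre: first plus last degree is always twice
    [o] plus [s + l1 + l2 + l3]. One bound on [a] therefore serves [string_diff] on each of them. *)
Lemma box_diff (s l1 l2 l3 o a : nat) :
  a.*2 <= o.*2 + (s + l1 + l2 + l3).+1 ->
  \sum_(c0 < s.+1) \sum_(c1 < l1.+1) \sum_(c2 < l2.+1) \sum_(c3 < l3.+1)
    (c0 + c1 + c2 + c3 + o == a) =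
  \sum_(c0 < s.+1) \sum_(c1 < l1.+1) \sum_(c2 < l2.+1) \sum_(c3 < l3.+1)
    ((c0 + c1 + c2 + c3 + o).+1 == a) +
  \sum_(c1 < (minn s l1).+1) \sum_(c2 < (minn (s + l1 - c1.*2) l2).+1)
    \sum_(c3 < (minn (s + l1 - c1.*2 + l2 - c2.*2) l3).+1)
      (c1 + c2 + c3 + o == a).
Proof.
move=> le_a; rewrite (clebsch_gordan4 s l1 l2 l3 (fun x => x + o == a)).
rewrite (clebsch_gordan4 s l1 l2 l3 (fun x => (x + o).+1 == a)).
rewrite -big_split; apply: eq_bigr => c1 _.
rewrite -big_split; apply: eq_bigr => c2 _.
rewrite -big_split; apply: eq_bigr => c3 _ /=.
under eq_bigr do rewrite -addnA.
under [X in _ = X + _]eq_bigr do rewrite -addnA.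
apply: string_diff.
have := ltn_ord c1; have := ltn_ord c2; have := ltn_ord c3; lia.
Qed.

(** * Fillings, sorted rows and column strictness *)

Lemma mem_seqs_len (k n : nat) (r : seq nat) :
  (r \in seqs_len k n) = (size r == k) && all (fun x => x < n) r.
Proof.
elim: k r => [|k IHk] r; first by rewrite /= inE; case: r.
apply/allpairsP/idP => [[[i r'] /= [hi hr ->]]|].
  by move: hi hr; rewrite IHk mem_iota /= => -> /andP[/eqP-> ->]; rewrite eqxx.
case: r => [//|i r'] /= /andP[sz /andP[hi hr]].
by exists (i, r'); rewrite IHk mem_iota /= hi hr andbT.
Qed.

Lemma uniq_seqs_len (k n : nat) : uniq (seqs_len k n).
Proof.
elim: k => [//|k IHk]; apply: allpairs_uniq; rewrite ?iota_uniq //.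
by move=> [i r] [i' r'] _ _ /= [-> ->].
Qed.

Lemma mem_fillings (lam : seq nat) (n : nat) (t : seq (seq nat)) :
  (t \in fillings lam n) =
  (map size t == lam) && all (all (fun x => x < n)) t.
Proof.
elim: lam t => [|k lam IH] t; first by rewrite /= inE; case: t.
apply/allpairsP/idP => [[[r t'] /= [hr ht ->]]|].
  move: hr ht; rewrite mem_seqs_len IH /= => /andP[/eqP-> ->] /andP[/eqP-> ->].
  by rewrite eqxx.
case: t => [//|r t'] /=.
rewrite eqseq_cons => /andP[/andP[/eqP hk ht] /andP[hr ht']].
by exists (r, t'); rewrite /= mem_seqs_len IH hk eqxx hr ht ht'.
Qed.

Lemma uniq_fillings (lam : seq nat) (n : nat) : uniq (fillings lam n).
Proof.
elim: lam => [//|k lam IH]; apply: allpairs_uniq; rewrite ?uniq_seqs_len //.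
by move=> [i r] [i' r'] _ _ /= [-> ->].
Qed.

Lemma schur_coef_rcons0 (lam alpha : seq nat) :
  schur_coef (rcons lam 0) alpha = schur_coef lam alpha.
Proof.
rewrite /schur_coef; set n := size alpha.
have -> : fillings (rcons lam 0) n = [seq rcons t [::] | t <- fillings lam n].
  elim: lam => [//|k lam IH] /=; rewrite IH.
  elim: (seqs_len k n) => //= r rs ->; rewrite map_cat -!map_comp.
  by congr (_ ++ _).
rewrite count_map; apply: eq_count => t /=.
rewrite /content -cats1 flatten_cat /= cats0; congr (_ && _).
rewrite /is_ssyt all_cat /= andbT; congr (_ && _).
case: t => [//|r t].
(* The empty row adds one more pair of consecutive rows, whose column condition is vacuous. *)
have -> : (size ((r :: t) ++ [:: [::]])).-1 = size t + 1 by rewrite size_cat.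
rewrite iotaD all_cat /= add0n nth_cat ltnn subnn /= !andbT.
apply: eq_in_all => i; rewrite mem_iota /= add0n => hi.
have -> : nth [::] (r :: t ++ [:: [::]]) i = nth [::] (r :: t) i.
  by rewrite -cat_cons nth_cat /= ltnS (ltnW hi).
by rewrite nth_cat hi.
Qed.

Lemma nth_sorted_leq (r : seq nat) (j v : nat) : sorted leq r -> j < size r ->
  (nth 0 r j <= v) = (j < count (fun x => x <= v) r).
Proof.
elim: r j => [//|x r IH] j /= hp.
have hr := path_sorted hp; have hx := order_path_min leq_trans hp.
case: (leqP x v) => xv.
  by case: j => [|j] hj; rewrite ?xv //= add1n ltnS IH.
rewrite add0n.
have -> : count (fun y => y <= v) r = 0.
  apply/eqP; rewrite eqn0Ngt -has_count; apply/hasPn => y yr.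
  by move/allP/(_ y yr): hx; lia.
case: j => [|j] hj /=; first by lia.
rewrite ltn0; apply/negbTE; rewrite -ltnNge; apply: leq_trans xv _.
by apply: (allP hx); apply: mem_nth.
Qed.

Definition col_strict (r r' : seq nat) : bool :=
  all (fun j => nth 0 r j < nth 0 r' j) (iota 0 (size r')).

(** By sortedness both counts are lengths of prefixes: the prefix of [r'] with entries at most [v]
    has to sit under the prefix of [r] with entries below [v]. *)
Lemma col_strictP (r r' : seq nat) :
  sorted leq r -> sorted leq r' -> size r' <= size r ->
  reflect (forall v, count (fun x => x <= v) r' <= count (fun x => x < v) r)
          (col_strict r r').
Proof.
move=> sr sr' le_r; apply: (iffP allP) => [H v|H j].
  case E: (count _ r') => [//|m].
  have hm : m < size r' by rewrite -E count_size.
  have /H lt : m \in iota 0 (size r') by rewrite mem_iota.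
  have : nth 0 r' m <= v by rewrite nth_sorted_leq // E.
  case: v {E} => [|v] le_v; first by lia.
  have -> : count (fun x => x < v.+1) r = count (fun x => x <= v) r by [].
  by rewrite -nth_sorted_leq //; lia.
rewrite mem_iota /= add0n => hj.
have := H (nth 0 r' j).
have := nth_sorted_leq r' j (nth 0 r' j) sr' hj; rewrite leqnn => /esym h1 h2.
have {h1 h2} := leq_trans h1 h2.
case: (nth 0 r' j) => [|v].
  by rewrite (@eq_count _ _ pred0) ?count_pred0.
by rewrite -nth_sorted_leq //; lia.
Qed.

(* The weakly increasing row of length [k] over the letters 0..3 in which
   [c0], [c1], [c2] entries are at most 0, 1, 2 respectively. *)
Definition wrow (c0 c1 c2 k : nat) : seq nat :=
  nseq c0 0 ++ nseq (c1 - c0) 1 ++ nseq (c2 - c1) 2 ++ nseq (k - c2) 3.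
Arguments wrow : simpl never.

Lemma count_row (p : pred nat) (c0 c1 c2 k : nat) :
  count p (wrow c0 c1 c2 k) =
  p 0 * c0 + p 1 * (c1 - c0) + p 2 * (c2 - c1) + p 3 * (k - c2).
Proof. by rewrite !count_cat !count_nseq !addnA. Qed.

Lemma size_row (c0 c1 c2 k : nat) : c0 <= c1 <= c2 -> c2 <= k ->
  size (wrow c0 c1 c2 k) = k.
Proof. by move=> h1 h2; rewrite !size_cat !size_nseq; lia. Qed.

Lemma sorted_row (c0 c1 c2 k : nat) : sorted leq (wrow c0 c1 c2 k).
Proof.
rewrite (sorted_pairwise leq_trans) !pairwise_cat.
have H m x : pairwise leq (nseq m x).
  rewrite -(sorted_pairwise leq_trans); elim: m => [//|[//|m]] /= ->.
  by rewrite leqnn.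
rewrite !H /= !andbT; apply/and3P; split; apply/allrelP => x y;
  rewrite ?mem_cat !mem_nseq; lia.
Qed.

Lemma sorted_rowE (r : seq nat) : sorted leq r -> all (fun x => x < 4) r ->
  r = wrow (count (fun x => x <= 0) r) (count (fun x => x <= 1) r)
          (count (fun x => x <= 2) r) (size r).
Proof.
move=> sr r4; apply: (sorted_eq leq_trans anti_leq sr (sorted_row _ _ _ _)).
have mono v : count (fun x => x <= v.+1) r
    = count (fun x => x <= v) r + count_mem v.+1 r.
  rewrite -count_predUI [X in _ = _ + X](@eq_count _ _ pred0) ?count_pred0 => [|x /=].
    by rewrite addn0; apply: eq_count => x /=; lia.
  by lia.
have sz : size r = count (fun x => x <= 3) r.
  by apply/esym/eqP; rewrite -all_count; apply: sub_all r4 => x; lia.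
have m0 : count (fun x => x <= 0) r = count_mem 0 r by apply: eq_count => x /=; lia.
apply/allP => x _; rewrite /= count_row.
rewrite sz !mono m0.
case: x => [|[|[|[|x]]]] /=; rewrite ?mul0n ?mul1n; [lia..|].
rewrite !addn0; apply/eqP/eqP.
rewrite eqn0Ngt -has_count; apply/hasPn => y /(allP r4) /=; lia.
Qed.

(** The count criterion at [v = 0, 1, 2, 3] gives the interlacing of Gelfand-Tsetlin patterns;
    larger [v] ask only for [m <= k]. *)
Lemma col_strict_row (c0 c1 c2 k d0 d1 d2 m : nat) :
  c0 <= c1 <= c2 -> c2 <= k -> d0 <= d1 <= d2 -> d2 <= m -> m <= k ->
  col_strict (wrow c0 c1 c2 k) (wrow d0 d1 d2 m) =
  [&& d0 == 0, d1 <= c0, d2 <= c1 & m <= c2].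
Proof.
move=> h1 h2 h3 h4 h5.
apply/col_strictP/idP; rewrite ?sorted_row ?size_row // => H.
  by move: (H 0) (H 1) (H 2) (H 3); rewrite !count_row /=; lia.
by case=> [|[|[|[|v]]]]; rewrite !count_row /= ?mul1n ?mul0n; lia.
Qed.

(** * Reindexing sums over intervals *)

(** The coordinate [c = m - k] measures the interval down from its top, so that the inequalities of
    a pattern become ranges starting at 0. *)
Lemma sum_box (m l M : nat) (G : nat -> nat) : l <= m < M ->
  \sum_(k < M) (m - l <= k <= m) * G k = \sum_(c < l.+1) G (m - c).
Proof.
move=> /andP[lm mM].
rewrite (eq_bigr (fun k : 'I_M => if k < m.+1 then (m - l <= k) * G k else 0)); last first.
  move=> k _; rewrite ltnS; case: (k <= m); rewrite ?andbT ?andbF //.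
rewrite -big_mkcond -(big_ord_widen M (fun k => (m - l <= k) * G k)) //.
rewrite (reindex_inj rev_ord_inj) /=.
rewrite (big_ord_widen m.+1 (fun c => G (m - c))) // [RHS]big_mkcond.
apply: eq_bigr => c _; have := ltn_ord c; rewrite subSS.
have -> : (m - l <= m - c) = (c < l.+1) by have := ltn_ord c; lia.
by case: ifP; rewrite ?mul1n ?mul0n.
Qed.

Lemma sum_box_rev (m l M : nat) (G : nat -> nat) : l <= m < M ->
  \sum_(c < l.+1) G c = \sum_(k < M) (m - l <= k <= m) * G (m - k).
Proof.
move=> lm; rewrite (@sum_box m l M (fun k => G (m - k)) lm).
by apply: eq_bigr => c _; rewrite subKn //; have := ltn_ord c; lia.
Qed.

(** * The substituted Schur polynomial as a sum over Gelfand-Tsetlin patterns *)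

(** A tableau has one content, so it matches at most one quadruple [(c1, c2, c3, c4)]; the degree
    conditions force that quadruple into the ranges of the sums. *)
Lemma schur_sub_coef_count (lam : seq nat) (a1 a2 b1 b2 : nat) :
  let n t i := count_mem i (flatten t) in
  schur_sub_coef lam a1 a2 b1 b2 =
  count (fun t => is_ssyt t &&
           [&& n t 0 + n t 1 == a1, n t 2 + n t 3 == a2,
               n t 0 + n t 2 == b1 & n t 1 + n t 3 == b2])
        (fillings lam 4).
Proof.
move=> n; rewrite /schur_sub_coef !pair_big /=.
pose C (p : 'I_a1.+1 * 'I_a1.+1 * 'I_a2.+1 * 'I_a2.+1) : bool :=
  [&& p.1.1.1 + p.1.1.2 == a1, p.1.2 + p.2 == a2, p.1.1.1 + p.1.2 == b1
    & p.1.1.2 + p.2 == b2].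
pose E t (p : 'I_a1.+1 * 'I_a1.+1 * 'I_a2.+1 * 'I_a2.+1) : bool :=
  [&& n t 0 == p.1.1.1, n t 1 == p.1.1.2, n t 2 == p.1.2 & n t 3 == p.2].
rewrite (eq_bigr (fun p => \sum_(t <- fillings lam 4) (is_ssyt t && (C p && E t p)))); last first.
  move=> [[[c1 c2] c3] c4] _ /=; rewrite /C /=.
  case: ifP => _; last by rewrite big1 // => t _; rewrite andbF.
  rewrite /schur_coef -sum1_count big_mkcond; apply: eq_bigr => t _ /=.
  by rewrite /E /= /content /= !eqseq_cons andbT; case: (_ && _).
rewrite exchange_big -sum1_count [RHS]big_mkcond; apply: eq_bigr => t _ /=.
case: (is_ssyt t); last by rewrite big1.
set Q := [&& _, _, _ & _].
transitivity #|[pred p | C p && E t p]|.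
  by rewrite -sum1_card [RHS]big_mkcond; apply: eq_bigr => p _ /=; rewrite inE; case: (_ && _).
case: (boolP Q) => /= HQ; last first.
  apply: eq_card0 => p; rewrite !inE; apply: contraNF HQ; rewrite /C /E /Q.
  case: p => [[[c1 c2] c3] c4] /=; clear.
  by move: (n t 0) (n t 1) (n t 2) (n t 3) => ????; lia.
have [h0 h1 h2 h3] : [/\ n t 0 < a1.+1, n t 1 < a1.+1, n t 2 < a2.+1 & n t 3 < a2.+1].
  by move: HQ; rewrite /Q; clear; move: (n t 0) (n t 1) (n t 2) (n t 3) => ????; split; lia.
apply: (@eq_card1 _ (Ordinal h0, Ordinal h1, Ordinal h2, Ordinal h3)) => p.
rewrite !inE /C /E; case: p => [[[c1 c2] c3] c4] /=.
rewrite !xpair_eqE -!val_eqE /= -!andbA.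
move: HQ; rewrite /Q; clear.
move: (n t 0) (n t 1) (n t 2) (n t 3) => ????; lia.
Qed.

(* The inner row [(a1, a2)] is replaced by its Bender-Knuth reflection, so that
   the letters 1 and 2 occur [k1 + k2 + k3 - a1 - a2] and [a1 + a2 - r] times. *)
Definition gt_tableau (l1 l2 l3 l4 a1 a2 r k1 k2 k3 : nat) : seq (seq nat) :=
  [:: wrow r (maxn k2 r + k1 - a1) k1 l1; wrow 0 (k3 + minn k2 r - a2) k2 l2;
      wrow 0 0 k3 l3; wrow 0 0 0 l4].

Definition gt_pattern (l1 l2 l3 l4 a1 a2 r k1 k2 k3 : nat) : bool :=
  [&& a2 <= r <= a1, maxn a1 l2 <= k1 <= l1, maxn a2 l3 <= k2 <= minn a1 l2
    & l4 <= k3 <= minn a2 l3].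

Lemma is_ssyt4 (r1 r2 r3 r4 : seq nat) :
  is_ssyt [:: r1; r2; r3; r4] =
  [&& sorted leq r1, sorted leq r2, sorted leq r3 & sorted leq r4] &&
  [&& col_strict r1 r2, col_strict r2 r3 & col_strict r3 r4].
Proof. by rewrite /is_ssyt /= !andbT. Qed.

Lemma row_inj (c0 c1 c2 k d0 d1 d2 : nat) :
  c0 <= c1 <= c2 -> d0 <= d1 <= d2 ->
  wrow c0 c1 c2 k = wrow d0 d1 d2 k -> [/\ c0 = d0, c1 = d1 & c2 = d2].
Proof.
move=> h1 h2 e.
have := congr1 (count (fun x => x <= 0)) e.
have := congr1 (count (fun x => x <= 1)) e.
have := congr1 (count (fun x => x <= 2)) e.
by rewrite !count_row /=; split; lia.
Qed.

Lemma row_form (r : seq nat) (k : nat) : sorted leq r -> size r = k ->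
  all (fun x => x < 4) r ->
  exists c0 c1 c2, [/\ r = wrow c0 c1 c2 k, c0 <= c1 <= c2 & c2 <= k].
Proof.
move=> sr <- r4; exists (count (fun x => x <= 0) r), (count (fun x => x <= 1) r).
exists (count (fun x => x <= 2) r); split; first exact: sorted_rowE.
  by apply/andP; split; apply: sub_count => x /=; lia.
exact: count_size.
Qed.

Lemma row_lt (n c0 c1 c2 k : nat) : c0 <= c1 <= c2 -> c2 <= k ->
  all (fun x => x < n) (wrow c0 c1 c2 k) =
  [&& (0 < n) || (c0 == 0), (1 < n) || (c0 == c1), (2 < n) || (c1 == c2)
    & (3 < n) || (c2 == k)].
Proof. by move=> h1 h2; rewrite all_count count_row size_row //; lia. Qed.

Lemma perm_ssyt4 (l1 l2 l3 l4 : nat) (I := 'I_l1.+1) :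
  l4 <= l3 -> l3 <= l2 -> l2 <= l1 ->
  perm_eq [seq t <- fillings [:: l1; l2; l3; l4] 4 | is_ssyt t]
    [seq (let: (a1, a2, r, k1, k2, k3) := p in
          gt_tableau l1 l2 l3 l4 a1 a2 r k1 k2 k3)
      | p : I * I * I * I * I * I <- enum [pred p : I * I * I * I * I * I |
          let: (a1, a2, r, k1, k2, k3) := p in
          gt_pattern l1 l2 l3 l4 a1 a2 r k1 k2 k3]].
Proof.
move=> h43 h32 h21; apply: uniq_perm.
- exact/filter_uniq/uniq_fillings.
- rewrite map_inj_in_uniq ?enum_uniq //.
  move=> [[[[[a1 a2] r] k1] k2] k3] [[[[[a1' a2'] r'] k1'] k2'] k3'].
  rewrite !mem_enum !inE /gt_pattern => h h' [].
  case/row_inj=> [||/ord_inj er e1 /ord_inj ek1]; [lia|lia|subst r' k1'].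
  case/row_inj=> [||_ e2 /ord_inj ek2]; [lia|lia|subst k2'].
  case/row_inj=> [||_ _ /ord_inj ek3]; [lia|lia|subst k3'].
  have -> : a1 = a1' by apply: val_inj => /=; lia.
  by have -> : a2 = a2' by apply: val_inj => /=; lia.
move=> t; rewrite mem_filter mem_fillings; apply/idP/mapP.
  case/and3P=> st /eqP sz al.
  case: t sz st al => [|r1 [|r2 [|r3 [|r4 [|? ?]]]]] //= [z1 z2 z3 z4].
  rewrite is_ssyt4 andbT => /andP[/and4P[s1 s2 s3 s4] cs] /and4P[i1 i2 i3 i4].
  have [a0 [a1 [a2 [ea ha ha']]]] := row_form _ _ s1 z1 i1.
  have [b0 [b1 [b2 [eb hb hb']]]] := row_form _ _ s2 z2 i2.
  have [c0 [c1 [c2 [ec hc hc']]]] := row_form _ _ s3 z3 i3.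
  have [d0 [d1 [d2 [ed hd hd']]]] := row_form _ _ s4 z4 i4.
  subst r1 r2 r3 r4; move: cs; rewrite !col_strict_row // => cs.
  (* A reflection is its own inverse, so [a1] and [a2] are recovered by the same formulas that
     define the reflected entries in [gt_tableau]. *)
  pose x1 := maxn b2 a0 + a2 - a1; pose x2 := c2 + minn b2 a0 - b1.
  have [e1 e2 e3 e4 e5] : [/\ x1 < l1.+1, x2 < l1.+1, a0 < l1.+1, a2 < l1.+1 & b2 < l1.+1].
    by rewrite /x1 /x2; split; lia.
  have e6 : c2 < l1.+1 by lia.
  exists (Ordinal e1, Ordinal e2, Ordinal e3, Ordinal e4, Ordinal e5, Ordinal e6).
    by rewrite mem_enum inE /gt_pattern /= /x1 /x2; lia.
  rewrite /gt_tableau /= /x1 /x2.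
  congr [:: _; _; _; _]; congr wrow; lia.
case=> [[[[[[a1 a2] r] k1] k2] k3]].
rewrite mem_enum inE /gt_pattern => h ->.
rewrite /gt_tableau is_ssyt4 !sorted_row !col_strict_row /=; try lia.
rewrite !size_row /= ?row_lt /=; try lia.
by rewrite eqxx; lia.
Qed.

Lemma count_ssyt4 (l1 l2 l3 l4 : nat) (Q : pred (seq (seq nat))) :
  l4 <= l3 -> l3 <= l2 -> l2 <= l1 ->
  count (fun t => is_ssyt t && Q t) (fillings [:: l1; l2; l3; l4] 4) =
  \sum_(a1 < l1.+1) \sum_(a2 < l1.+1) \sum_(r < l1.+1)
  \sum_(k1 < l1.+1) \sum_(k2 < l1.+1) \sum_(k3 < l1.+1)
    (gt_pattern l1 l2 l3 l4 a1 a2 r k1 k2 k3 &&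
     Q (gt_tableau l1 l2 l3 l4 a1 a2 r k1 k2 k3)).
Proof.
move=> h43 h32 h21; rewrite !pair_big /=.
rewrite (eq_count (a2 := predI Q is_ssyt)) => [|t /=]; last by rewrite andbC.
rewrite -count_filter (permP (perm_ssyt4 _ _ _ _ h43 h32 h21)) count_map.
rewrite -sum1_count big_enum_cond /= big_mkcond /=; apply: eq_bigr.
by move=> [[[[[a1 a2] r] k1] k2] k3] _ /=; rewrite inE; case: (_ && _).
Qed.

(** [p] tests the exponent of x2 and [q] that of y2. Thanks to the reflection the latter depends on
    [a1] and [a2] alone, so [q] is constant in the four inner sums. *)
Definition gt_sum (l1 l2 l3 l4 : nat) (p q : pred nat) : nat :=
  \sum_(a1 < l1.+1) \sum_(a2 < l1.+1) \sum_(r < l1.+1)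
  \sum_(k1 < l1.+1) \sum_(k2 < l1.+1) \sum_(k3 < l1.+1)
    (gt_pattern l1 l2 l3 l4 a1 a2 r k1 k2 k3 &&
     (p (a1 + a2 - r + (l1 + l2 + l3 + l4 - (k1 + k2 + k3))) &&
      q (l1 + l2 + l3 + l4 - (a1 + a2)))).

Lemma content_gt_tableau (l1 l2 l3 l4 a1 a2 r k1 k2 k3 : nat)
    (n := fun i => count_mem i (flatten (gt_tableau l1 l2 l3 l4 a1 a2 r k1 k2 k3))) :
  gt_pattern l1 l2 l3 l4 a1 a2 r k1 k2 k3 ->
  [/\ n 0 = r, n 1 = k1 + k2 + k3 - (a1 + a2), n 2 = a1 + a2 - r
    & n 3 = l1 + l2 + l3 + l4 - (k1 + k2 + k3)].
Proof.
rewrite /gt_pattern => h.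
by rewrite /n /gt_tableau /= !cats0 !count_cat !count_nseq /= ?mul1n ?mul0n; split; lia.
Qed.

Lemma schur_sub_coef_gt (l1 l2 l3 l4 a b : nat) (N := l1 + l2 + l3 + l4) :
  l4 <= l3 -> l3 <= l2 -> l2 <= l1 -> a <= N -> b <= N ->
  schur_sub_coef [:: l1; l2; l3; l4] (N - a) a (N - b) b =
  gt_sum l1 l2 l3 l4 (pred1 a) (pred1 b).
Proof.
move=> h43 h32 h21 ha hb; rewrite schur_sub_coef_count count_ssyt4 //.
apply: eq_bigr => a1 _; apply: eq_bigr => a2 _; apply: eq_bigr => r _.
apply: eq_bigr => k1 _; apply: eq_bigr => k2 _; apply: eq_bigr => k3 _.
congr nat_of_bool; case E: gt_pattern => //=.
have [-> -> -> ->] := content_gt_tableau _ _ _ _ _ _ _ _ _ _ E.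
have [hr hk hN] : [/\ r <= a1, a1 + a2 <= k1 + k2 + k3 & k1 + k2 + k3 <= N].
  by move: E; rewrite /gt_pattern /N => E; split; lia.
by move: ha hb hr hk hN; rewrite /N; clear; lia.
Qed.

(** * Highest weights for x: the difference in the x-degree *)

(* The last three inequalities are the successive Clebsch-Gordan bounds
   [c1 <= s], [c2 <= s + L1 - 2 c1], [c3 <= s + L1 + L2 - 2 c1 - 2 c2], rewritten
   in the coordinates of the pattern. *)
Definition hw_pattern (l1 l2 l3 l4 a1 a2 k1 k2 k3 : nat) : bool :=
  [&& a2 <= a1, maxn a1 l2 <= k1 <= l1, maxn a2 l3 <= k2 <= minn a1 l2,
      l4 <= k3 <= minn a2 l3, l1 + a2 <= a1 + k1,
      l1 + l2 + a2 <= k1.*2 + k2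
    & l1 + l2 + l3 + a2.*2 <= k1.*2 + k2.*2 + k3].

(** The summand [a2] is [a1 + a2 - r] at [r = a1]: a highest weight stands where its string starts,
    with the coordinate of [r] equal to 0. *)
Definition hw_sum (l1 l2 l3 l4 a : nat) (q : pred nat) : nat :=
  \sum_(a1 < l1.+1) \sum_(a2 < l1.+1)
  \sum_(k1 < l1.+1) \sum_(k2 < l1.+1) \sum_(k3 < l1.+1)
    (hw_pattern l1 l2 l3 l4 a1 a2 k1 k2 k3 &&
     ((a2 + (l1 + l2 + l3 + l4 - (k1 + k2 + k3)) == a) &&
      q (l1 + l2 + l3 + l4 - (a1 + a2)))).

Section FixedMiddleRow.
Variables (l1 l2 l3 l4 a1 a2 : nat).
Hypotheses (h43 : l4 <= l3) (h32 : l3 <= l2) (h21 : l2 <= l1).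
Hypotheses (ha1 : l3 <= a1 <= l1) (ha2 : l4 <= a2 <= minn a1 l2).

(** [s], [L1], [L2], [L3] are the lengths of the intervals of [r], [k1], [k2], [k3], which the
    bounds on [a1] and [a2] make nonempty. [o] is the x-degree when all four variables are at their
    tops. *)
Let s := a1 - a2.
Let L1 := l1 - maxn a1 l2.
Let m2 := minn a1 l2.
Let L2 := m2 - maxn a2 l3.
Let m3 := minn a2 l3.
Let L3 := m3 - l4.
Let N := l1 + l2 + l3 + l4.
Let o := a2 + (N - (l1 + m2 + m3)).

Let le_a21 : a2 <= a1. Proof. by clear -ha2; lia. Qed.
Let le_M1 : maxn a1 l2 <= l1. Proof. by clear -ha1 h21; lia. Qed.
Let le_M2 : maxn a2 l3 <= m2.
Proof. by rewrite /m2; clear -ha1 ha2 h32; lia. Qed.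
Let le_m3 : l4 <= m3. Proof. by rewrite /m3; clear -ha2 h43; lia. Qed.
Let box0 : a1 - s = a2.
Proof. exact: subKn le_a21. Qed.
Let box1 : l1 - L1 = maxn a1 l2.
Proof. exact: subKn le_M1. Qed.
Let box2 : m2 - L2 = maxn a2 l3.
Proof. exact: subKn le_M2. Qed.
Let box3 : m3 - L3 = l4.
Proof. exact: subKn le_m3. Qed.
(** With the maxima treated as atoms, these two identities keep the comparison of degrees within
    linear arithmetic. *)
Let max_min1 : m2 + maxn a1 l2 = a1 + l2.
Proof. exact: addn_min_max a1 l2. Qed.
Let max_min2 : m3 + maxn a2 l3 = a2 + l3.
Proof. exact: addn_min_max a2 l3. Qed.
Let le_m2 : m2 <= l1. Proof. by rewrite /m2; clear -ha1; lia. Qed.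
Let le_m3' : m3 <= l1. Proof. by rewrite /m3; clear -h32 h21; lia. Qed.
Let le_N : l1 + m2 + m3 <= N.
Proof. by rewrite /N /m2 /m3; clear; lia. Qed.
Let sE : a1 = a2 + s. Proof. by rewrite /s subnKC. Qed.
Let L1E : l1 = L1 + maxn a1 l2. Proof. by rewrite /L1 subnK. Qed.
Let L2E : m2 = L2 + maxn a2 l3. Proof. by rewrite /L2 subnK. Qed.
Let L3E : m3 = L3 + l4. Proof. by rewrite /L3 subnK. Qed.

Lemma gt_sum_box (p : pred nat) (q : bool) :
  \sum_(r < l1.+1) \sum_(k1 < l1.+1) \sum_(k2 < l1.+1) \sum_(k3 < l1.+1)
    (gt_pattern l1 l2 l3 l4 a1 a2 r k1 k2 k3 &&
     (p (a1 + a2 - r + (N - (k1 + k2 + k3))) && q)) =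
  q * \sum_(c0 < s.+1) \sum_(c1 < L1.+1) \sum_(c2 < L2.+1) \sum_(c3 < L3.+1)
    p (c0 + c1 + c2 + c3 + o).
Proof.
pose G3 r k1 k2 k3 : nat := p (a1 + a2 - r + (N - (k1 + k2 + k3))) && q.
pose G2 r k1 k2 := \sum_(k3 < l1.+1) (m3 - L3 <= k3 <= m3) * G3 r k1 k2 k3.
pose G1 r k1 := \sum_(k2 < l1.+1) (m2 - L2 <= k2 <= m2) * G2 r k1 k2.
pose G0 r := \sum_(k1 < l1.+1) (l1 - L1 <= k1 <= l1) * G1 r k1.
transitivity (\sum_(r < l1.+1) (a1 - s <= r <= a1) * G0 r).
  apply: eq_bigr => r _; rewrite big_distrr; apply: eq_bigr => k1 _.
  rewrite /= mulnA big_distrr; apply: eq_bigr => k2 _.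
  rewrite /= mulnA big_distrr; apply: eq_bigr => k3 _.
  rewrite /= mulnA /G3 !mulnb; congr nat_of_bool; congr (_ && _).
  by rewrite /gt_pattern box0 box1 box2 box3 -!andbA.
rewrite (sum_box a1 s l1.+1 G0); last by clear -ha1; rewrite leq_subr; lia.
rewrite big_distrr; apply: eq_bigr => c0 _.
rewrite /G0 (sum_box l1 L1 l1.+1 (G1 (a1 - c0))); last by rewrite leq_subr /=.
rewrite /= big_distrr; apply: eq_bigr => c1 _.
rewrite /G1 (sum_box m2 L2 l1.+1 (G2 (a1 - c0) (l1 - c1)));
  last by rewrite leq_subr ltnS le_m2.
rewrite /= big_distrr; apply: eq_bigr => c2 _.
rewrite /G2 (sum_box m3 L3 l1.+1 (G3 (a1 - c0) (l1 - c1) (m2 - c2))); last first.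
  by rewrite leq_subr ltnS le_m3'.
rewrite /= big_distrr; apply: eq_bigr => c3 _.
rewrite /= /G3 mulnb andbC; congr (nat_of_bool (_ && p _)).
move: (ltn_ord c0) (ltn_ord c1) (ltn_ord c2) (ltn_ord c3).
move: le_N sE L1E L2E L3E; rewrite /o; clearbody N L1 L2 L3 s m2 m3; clear.
by move: (maxn a1 l2) (maxn a2 l3) => *; lia.
Qed.

Lemma hw_sum_box (a : nat) (q : bool) :
  \sum_(k1 < l1.+1) \sum_(k2 < l1.+1) \sum_(k3 < l1.+1)
    (hw_pattern l1 l2 l3 l4 a1 a2 k1 k2 k3 &&
     ((a2 + (N - (k1 + k2 + k3)) == a) && q)) =
  q * \sum_(c1 < (minn s L1).+1) \sum_(c2 < (minn (s + L1 - c1.*2) L2).+1)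
    \sum_(c3 < (minn (s + L1 - c1.*2 + L2 - c2.*2) L3).+1)
      (c1 + c2 + c3 + o == a).
Proof.
pose G3 c1 c2 c3 : nat := c1 + c2 + c3 + o == a.
pose M2 c1 := minn (s + L1 - c1.*2) L2.
pose M3 c1 c2 := minn (s + L1 - c1.*2 + L2 - c2.*2) L3.
pose G2 c1 c2 := \sum_(c3 < (M3 c1 c2).+1) G3 c1 c2 c3.
pose G1 c1 := \sum_(c2 < (M2 c1).+1) G2 c1 c2.
rewrite (sum_box_rev l1 (minn s L1) l1.+1 G1);
  last by rewrite geq_min leq_subr orbT /=.
rewrite big_distrr; apply: eq_bigr => k1 _.
rewrite /G1 (sum_box_rev m2 (M2 (l1 - k1)) l1.+1 (G2 (l1 - k1))); last first.
  by rewrite geq_min leq_subr orbT ltnS le_m2.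
rewrite /= mulnA big_distrr; apply: eq_bigr => k2 _.
rewrite /G2 (sum_box_rev m3 (M3 (l1 - k1) (m2 - k2)) l1.+1 (G3 (l1 - k1) (m2 - k2)));
  last by rewrite geq_min leq_subr orbT ltnS le_m3'.
rewrite /= mulnA big_distrr; apply: eq_bigr => k3 _.
rewrite /= mulnA /G3 !mulnb; congr nat_of_bool.
case: q; rewrite ?andbF //= andbT.
(* Each minimum splits into the interval of the pattern and one Clebsch-Gordan bound on the
   coordinate [m - k]. *)
have boxmin m x y k : (m - minn x y <= k <= m) = (m - y <= k <= m) && (m - k <= x).
  by clear; lia.
rewrite /M2 /M3 !boxmin box1 box2 box3 /hw_pattern.
rewrite le_a21.
case A1: (maxn a1 l2 <= k1 <= l1); rewrite //=.
case A2: (maxn a2 l3 <= k2 <= minn a1 l2); rewrite ?andbF //=.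
case A3: (l4 <= k3 <= minn a2 l3); rewrite ?andbF //=.
rewrite -/m2 in A2; rewrite -/m3 in A3.
move: A1 A2 A3 le_N sE L1E L2E max_min1 max_min2.
rewrite /o; clearbody N L1 L2 L3 s m2 m3; clear.
move: (nat_of_ord k1) (nat_of_ord k2) (nat_of_ord k3) (maxn a1 l2) (maxn a2 l3).
clear k1 k2 k3 => k1 k2 k3 x y A1 A2 A3 hN hs hL1 hL2 e1 e2.
(* The bounds are treated in order: each one ensures that the subtraction in the next is not
   truncated. *)
case X1: (l1 - k1 <= s); last by rewrite (_ : l1 + a2 <= a1 + k1 = false) //; lia.
rewrite (_ : l1 + a2 <= a1 + k1) //=; last by lia.
have -> : (m2 - k2 <= s + L1 - (l1 - k1).*2) = (l1 + l2 + a2 <= k1.*2 + k2) by lia.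
case X2: (l1 + l2 + a2 <= k1.*2 + k2) => //=.
congr (_ && _); last by lia.
by lia.
Qed.

(** The common centre of the strings does not depend on [a1] and [a2]: twice [o] plus
    [s + L1 + L2 + L3] equals [N]. The bound on [a] is thus the one that [box_diff] needs. *)
Lemma gt_sum_diff_fixed (a : nat) (q : bool) : a.*2 <= N.+1 ->
  \sum_(r < l1.+1) \sum_(k1 < l1.+1) \sum_(k2 < l1.+1) \sum_(k3 < l1.+1)
    (gt_pattern l1 l2 l3 l4 a1 a2 r k1 k2 k3 &&
     ((a1 + a2 - r + (N - (k1 + k2 + k3)) == a) && q)) =
  \sum_(r < l1.+1) \sum_(k1 < l1.+1) \sum_(k2 < l1.+1) \sum_(k3 < l1.+1)
    (gt_pattern l1 l2 l3 l4 a1 a2 r k1 k2 k3 &&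
     (((a1 + a2 - r + (N - (k1 + k2 + k3))).+1 == a) && q)) +
  \sum_(k1 < l1.+1) \sum_(k2 < l1.+1) \sum_(k3 < l1.+1)
    (hw_pattern l1 l2 l3 l4 a1 a2 k1 k2 k3 &&
     ((a2 + (N - (k1 + k2 + k3)) == a) && q)).
Proof.
move=> le_a; rewrite (gt_sum_box (pred1 a)) (gt_sum_box (fun x => x.+1 == a)).
rewrite hw_sum_box -mulnDr /= box_diff //.
move: le_a le_N sE L1E L2E L3E max_min1 max_min2 (erefl N); rewrite {3}/N /o.
clearbody N L1 L2 L3 s m2 m3; clear.
by move: (maxn a1 l2) (maxn a2 l3) => *; lia.
Qed.

End FixedMiddleRow.

Lemma gt_sum_diff (l1 l2 l3 l4 a : nat) (q : pred nat) :
  l4 <= l3 -> l3 <= l2 -> l2 <= l1 -> a.*2 <= (l1 + l2 + l3 + l4).+1 ->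
  gt_sum l1 l2 l3 l4 (pred1 a) q =
  gt_sum l1 l2 l3 l4 (fun x => x.+1 == a) q + hw_sum l1 l2 l3 l4 a q.
Proof.
move=> h43 h32 h21 le_a; rewrite -big_split; apply: eq_bigr => a1 _.
rewrite -big_split; apply: eq_bigr => a2 _ /=.
have [h|h] := boolP ((l3 <= a1 <= l1) && (l4 <= a2 <= minn a1 l2)).
  by case/andP: h => h1 h2; apply: gt_sum_diff_fixed.
(* Outside these ranges one of the intervals is empty. *)
have gt0 r k1 k2 k3 : gt_pattern l1 l2 l3 l4 a1 a2 r k1 k2 k3 = false.
  by apply: contraNF h; rewrite /gt_pattern; lia.
have hw0 k1 k2 k3 : hw_pattern l1 l2 l3 l4 a1 a2 k1 k2 k3 = false.
  by apply: contraNF h; rewrite /hw_pattern; lia.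
rewrite !big1 // => [k1|r|r] _; last 2 first.
- by rewrite big1 // => k1 _; rewrite big1 // => k2 _; rewrite big1 // => k3 _; rewrite gt0.
- by rewrite big1 // => k1 _; rewrite big1 // => k2 _; rewrite big1 // => k3 _; rewrite gt0.
by rewrite big1 // => k2 _; rewrite big1 // => k3 _; rewrite hw0.
Qed.

(** * The difference in the y-degree and the bound by [pS] *)

Lemma leq_sum_inj (I J : finType) (P : pred I) (Q : pred J) (h : I -> J) :
  {in P &, injective h} -> (forall i, P i -> Q (h i)) ->
  \sum_i P i <= \sum_j Q j.
Proof.
move=> hinj hPQ; rewrite -!(big_mkcond _ (fun _ => 1)) !sum1_card.
rewrite -(card_in_image hinj); apply/subset_leq_card/subsetP => j.
by case/imageP => i Pi ->; apply: hPQ.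
Qed.

(** In [hw_pattern] the only upper bound on [a1] is [a1 <= k1], and [a1] does not enter the
    x-degree; the patterns that cannot be shifted are those with [a1 = k1]. *)
Lemma hw_sum_step (l1 l2 l3 l4 a b : nat) :
  hw_sum l1 l2 l3 l4 a (pred1 b) <=
  hw_sum l1 l2 l3 l4 a (fun y => y.+1 == b) +
  \sum_(a1 < l1.+1) \sum_(a2 < l1.+1)
  \sum_(k1 < l1.+1) \sum_(k2 < l1.+1) \sum_(k3 < l1.+1)
    [&& a1 == k1 :> nat, hw_pattern l1 l2 l3 l4 a1 a2 k1 k2 k3,
        a2 + (l1 + l2 + l3 + l4 - (k1 + k2 + k3)) == a
      & l1 + l2 + l3 + l4 - (a1 + a2) == b].
Proof.
rewrite /hw_sum.
pose P0 (a1 a2 k1 k2 k3 : nat) : nat := hw_pattern l1 l2 l3 l4 a1 a2 k1 k2 k3 &&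
     ((a2 + (l1 + l2 + l3 + l4 - (k1 + k2 + k3)) == a) &&
      (l1 + l2 + l3 + l4 - (a1 + a2) == b)).
pose P1 (a1 a2 k1 k2 k3 : nat) : nat := hw_pattern l1 l2 l3 l4 a1 a2 k1 k2 k3 &&
     ((a2 + (l1 + l2 + l3 + l4 - (k1 + k2 + k3)) == a) &&
      ((l1 + l2 + l3 + l4 - (a1 + a2)).+1 == b)).
pose P2 (a1 a2 k1 k2 k3 : nat) : nat :=
    [&& a1 == k1 :> nat, hw_pattern l1 l2 l3 l4 a1 a2 k1 k2 k3,
        a2 + (l1 + l2 + l3 + l4 - (k1 + k2 + k3)) == a
      & l1 + l2 + l3 + l4 - (a1 + a2) == b].
pose S (P : nat -> nat -> nat -> nat -> nat -> nat) a1 :=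
  \sum_(a2 < l1.+1) \sum_(k1 < l1.+1) \sum_(k2 < l1.+1) \sum_(k3 < l1.+1)
    P a1 a2 k1 k2 k3.
change (\sum_(a1 < l1.+1) S P0 a1 <=
        \sum_(a1 < l1.+1) S P1 a1 + \sum_(a1 < l1.+1) S P2 a1).
(* The sums are aligned along [a1 -> a1 + 1]: the term [a1 = l1] has no successor and is treated
   apart, and the term [a1 = 0] of [P1] is dropped at the end. *)
rewrite big_ord_recr [X in _ <= X + _]big_ord_recl [X in _ <= _ + X]big_ord_recr /=.
have step a1 : S P0 a1 <= S P1 a1.+1 + S P2 a1.
  rewrite -big_split; apply: leq_sum => a2 _; rewrite -big_split.
  apply: leq_sum => k1 _; rewrite -big_split; apply: leq_sum => k2 _.
  rewrite -big_split; apply: leq_sum => k3 _ /=.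
  rewrite /P0 /P1 /P2; case E: (hw_pattern _ _ _ _ a1) => //=.
  case: eqP => //= _; case: (eqVneq a1 (k1 : nat)) => [_|ne] /=; first by lia.
  have -> /= : hw_pattern l1 l2 l3 l4 a1.+1 a2 k1 k2 k3.
    by move: E; rewrite /hw_pattern; lia.
  (* Strictness makes the truncated y-degree drop by exactly one. *)
  have : a1 + a2 < l1 + l2 + l3 + l4 by move: E; rewrite /hw_pattern; lia.
  by clear; lia.
have last : S P0 l1 <= S P2 l1.
  apply: leq_sum => a2 _; apply: leq_sum => k1 _; apply: leq_sum => k2 _.
  apply: leq_sum => k3 _; rewrite /P0 /P2; case E: hw_pattern => //=.
  have -> : l1 == k1 :> nat by move: E; rewrite /hw_pattern; lia.
  by [].
have : \sum_(i < l1) S P0 i <= \sum_(i < l1) S P1 (lift ord0 i) + \sum_(i < l1) S P2 i.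
  by rewrite -big_split; apply: leq_sum => i _; apply: step.
by move=> H; apply: leq_trans (leq_add H last) _; rewrite -!addnA leq_addl.
Qed.

(** With [a1 = k1], put [x1 = k2 - a2], [x2 = l3 - k3], [x3 = l2 - k2], [x4 = l1 - k1]. The y-degree
    gives the first equation of [pS], the sum of both degrees gives the second, and the four values
    determine the pattern. *)
Lemma boundary_le_pS (l1 l2 l3 l4 a b : nat) :
  \sum_(a1 < l1.+1) \sum_(a2 < l1.+1)
  \sum_(k1 < l1.+1) \sum_(k2 < l1.+1) \sum_(k3 < l1.+1)
    [&& a1 == k1 :> nat, hw_pattern l1 l2 l3 l4 a1 a2 k1 k2 k3,
        a2 + (l1 + l2 + l3 + l4 - (k1 + k2 + k3)) == a
      & l1 + l2 + l3 + l4 - (a1 + a2) == b] <=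
  pS (b%:Z - l3%:Z - l4%:Z)%R (a%:Z + b%:Z - l2%:Z - l3%:Z - 2 * l4%:Z)%R.
Proof.
pose T (a1 a2 k1 k2 k3 : nat) := [&& a1 == k1 :> nat, hw_pattern l1 l2 l3 l4 a1 a2 k1 k2 k3,
        a2 + (l1 + l2 + l3 + l4 - (k1 + k2 + k3)) == a
      & l1 + l2 + l3 + l4 - (a1 + a2) == b].
have TP a1 a2 k1 k2 k3 : T a1 a2 k1 k2 k3 ->
  [/\ a1 = k1, k1 <= l1, a2 <= k2 <= l2, k3 <= l3
    & (l2 + l4 + (l1 - k1) + (l3 - k3) = a + (k2 - a2)) /\
      (l3 + l4 + (l1 - k1) + (l2 - k2) + (k2 - a2) = b)].
  by rewrite /T /hw_pattern => h; split; [..|split]; lia.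
(* Where [pS] is 0 by a negative argument there is no pattern, since both arguments would be sums of
   natural numbers. *)
case En: (_ - _ - _)%R => [n|n]; last first.
  rewrite big1 // => a1 _; rewrite big1 // => a2 _; rewrite big1 // => k1 _.
  rewrite big1 // => k2 _; rewrite big1 // => k3 _; apply/eqP; rewrite eqb0.
  by apply/negP => /TP[? ? ? ? []]; lia.
case Em: (_ - _ - _ - _)%R => [m|m]; last first.
  rewrite big1 // => a1 _; rewrite big1 // => a2 _; rewrite big1 // => k1 _.
  rewrite big1 // => k2 _; rewrite big1 // => k3 _; apply/eqP; rewrite eqb0.
  by apply/negP => /TP[? ? ? ? []]; lia.
rewrite /pS !pair_big /=.
pose h (p : 'I_l1.+1 * 'I_l1.+1 * 'I_l1.+1 * 'I_l1.+1 * 'I_l1.+1) :=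
  let: (a1, a2, k1, k2, k3) := p in
  (* The default value of [inord] never occurs on the patterns considered, by [bnd] below. *)
  (inord (k2 - a2), inord (l3 - k3), inord (l2 - k2), inord (l1 - k1))
  : 'I_n.+1 * 'I_m.+1 * 'I_n.+1 * 'I_n.+1.
have bnd a1 a2 k1 k2 k3 : T a1 a2 k1 k2 k3 ->
  [/\ k2 - a2 < n.+1, l3 - k3 < m.+1, l2 - k2 < n.+1 & l1 - k1 < n.+1].
  by case/TP => ? ? ? ? []; split; lia.
apply: (@leq_sum_inj _ _
  (fun p : 'I_l1.+1 * 'I_l1.+1 * 'I_l1.+1 * 'I_l1.+1 * 'I_l1.+1 =>
     T p.1.1.1.1 p.1.1.1.2 p.1.1.2 p.1.2 p.2)
  (fun p : 'I_n.+1 * 'I_m.+1 * 'I_n.+1 * 'I_n.+1 =>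
     (p.1.1.1 + p.1.2 + p.2 == n) && (p.1.1.2 + p.1.2 + 2 * p.2 == m)) h).
  move=> [[[[a1 a2] k1] k2] k3] [[[[a1' a2'] k1'] k2'] k3'].
  rewrite /in_mem /= => H H'.
  have [b1 b2 b3 b4] := bnd _ _ _ _ _ H; have [b1' b2' b3' b4'] := bnd _ _ _ _ _ H'.
  case=> /(congr1 val) /= + /(congr1 val) /= + /(congr1 val) /= + /(congr1 val) /=.
  rewrite !inordK // => e1 e2 e3 e4.
  have [q1 q2 q3 q4 _] := TP _ _ _ _ _ H; have [q1' q2' q3' q4' _] := TP _ _ _ _ _ H'.
  congr (_, _, _, _, _); apply: val_inj => /=; clear -e1 e2 e3 e4 q1 q2 q3 q4 q1' q2' q3' q4'; lia.
move=> [[[[a1 a2] k1] k2] k3] /= H; have [b1 b2 b3 b4] := bnd _ _ _ _ _ H.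
rewrite !inordK //; have [q1 q2 q3 q4 [q5 q6]] := TP _ _ _ _ _ H.
by clear -q1 q2 q3 q4 q5 q6 En Em; lia.
Qed.

(** * Schur polynomials in two variables and partial sums of Kronecker coefficients *)

Lemma is_ssyt2 (r1 r2 : seq nat) :
  is_ssyt [:: r1; r2] = [&& sorted leq r1, sorted leq r2 & col_strict r1 r2].
Proof. by rewrite /is_ssyt /= !andbT -andbA. Qed.

Lemma schur_coef2 (m1 m2 a1 a2 : nat) : m2 <= m1 ->
  schur_coef [:: m1; m2] [:: a1; a2] = (m2 <= a1 <= m1) && (a1 + a2 == m1 + m2).
Proof.
move=> h21; rewrite /schur_coef /=.
rewrite (eq_count (a2 := predI (fun t => content 2 t == [:: a1; a2]) is_ssyt));
  last by move=> t /=; rewrite andbC.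
(* Column strictness fills the second row with the letter 1, so the number [c] of letters 0 in the
   first row determines the tableau. *)
pose tab c := [:: wrow c m1 m1 m1; wrow 0 m2 m2 m2].
rewrite -count_filter.
have /permP-> : perm_eq [seq t <- fillings [:: m1; m2] 2 | is_ssyt t]
                  [seq tab c | c <- iota m2 (m1.+1 - m2)].
  apply: uniq_perm.
  - exact/filter_uniq/uniq_fillings.
  - rewrite map_inj_in_uniq ?iota_uniq // => c c'; rewrite !mem_iota => h h' [].
    by case/row_inj=> [||->]; lia.
  move=> t; rewrite mem_filter mem_fillings; apply/idP/mapP.
    case/and3P=> st /eqP sz al.
    case: t sz st al => [|r1 [|r2 [|? ?]]] //= [z1 z2].
    rewrite is_ssyt2 andbT => /and3P[s1 s2 cs] /andP[i1 i2].
    have lt4 r : all (fun x => x < 2) r -> all (fun x => x < 4) r.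
      by apply: sub_all => x; lia.
    have [a0 [a3 [a4 [ea ha ha']]]] := row_form _ _ s1 z1 (lt4 _ i1).
    have [b0 [b3 [b4 [eb hb hb']]]] := row_form _ _ s2 z2 (lt4 _ i2).
    subst r1 r2; move: cs i1 i2; rewrite col_strict_row // !row_lt //= => cs i1 i2.
    exists a0; first by rewrite mem_iota; lia.
    by congr [:: _; _]; congr wrow; lia.
  case=> c; rewrite mem_iota => h ->.
  rewrite /tab is_ssyt2 !sorted_row !col_strict_row /=; try lia.
  rewrite !size_row /= ?row_lt /=; try lia.
  by rewrite eqxx; lia.
rewrite count_map -sum1_count big_mkcond /=.
have cE c : c \in iota m2 (m1.+1 - m2) ->
  (content 2 (tab c) == [:: a1; a2]) = (c == a1) && (m1 + m2 - c == a2).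
  rewrite mem_iota => h.
  rewrite /content /tab /= cats0 !eqseq_cons !count_cat !count_nseq /= ?mul1n ?mul0n.
  by rewrite andbT; lia.
rewrite big_seq (eq_bigr (fun c => (c == a1) && (m1 + m2 - c == a2) : nat)); last first.
  by move=> c /cE->; case: (_ && _).
rewrite -big_seq; have [h|h] := boolP (a1 \in iota m2 (m1.+1 - m2)).
  rewrite (bigD1_seq a1) ?iota_uniq //= eqxx /= big1 => [|c /negPf-> //].
  by rewrite addn0; move: h; rewrite mem_iota => h; lia.
rewrite big_seq big1 => [|c hc]; last by case: eqP hc h => // -> ->.
by move: h; rewrite mem_iota => h; lia.
Qed.

Definition two_rows (N k : nat) : seq nat := filter (fun x => 0 < x) [:: N - k; k].
Arguments two_rows : simpl never.

(** Both [k] and [a] lie in the lower half, so [k <= N - a] is automatic and [N - a <= N - k]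
    remains. *)
Lemma schur_coef_two_rows (N k a : nat) : k <= N./2 -> a <= N./2 ->
  schur_coef (two_rows N k) [:: N - a; a] = (k <= a).
Proof.
move=> hk ha; transitivity (schur_coef [:: N - k; k] [:: N - a; a]).
  rewrite /two_rows /=; case: k hk => [|k] hk; case: posnP => [e|_] //=.
  - by rewrite e -(schur_coef_rcons0 [::]) -(schur_coef_rcons0 [:: 0]).
  - by rewrite -(schur_coef_rcons0 [:: _]).
  by lia.
by rewrite schur_coef2; lia.
Qed.

Lemma partition_two_rows (mu : seq nat) : is_partition mu -> size mu <= 2 ->
  mu = two_rows (sumn mu) (part mu 2) /\ part mu 2 <= (sumn mu)./2.
Proof.
rewrite /is_partition /two_rows /part.
case: mu => [|x [|y [|? ?]]] //=; rewrite ?andbT ?addn0 ?subn0.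
  by move=> -> _; split.
move=> /andP[yx /andP[x0 y0]] _; rewrite addnK x0 y0; split => //.
by rewrite /geq /= in yx; lia.
Qed.

Local Open Scope ring_scope.

(** The two-variable Schur coefficients are 0 or 1 and triangular, so expanding the definition of
    [g] leaves a partial sum. Kronecker coefficients are then mixed second differences. *)
Lemma kronecker_partial_sum (g : seq nat -> seq nat -> seq nat -> int)
    (lam : seq nat) (a b : nat) (N := sumn lam) :
  kronecker_spec g -> is_partition lam -> (a <= N./2)%N -> (b <= N./2)%N ->
  (schur_sub_coef lam (N - a) a (N - b) b)%:Z =
  \sum_(k < a.+1) \sum_(l < b.+1) g (two_rows N k) (two_rows N l) lam.
Proof.
move=> hg hlam ha hb.
have sum_parts2 (F : seq nat -> int) :
    \sum_(rho <- parts2 N) F rho = \sum_(k < (N./2).+1) F (two_rows N k).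
  by rewrite big_map -[iota 0 _]/(index_iota 0 (N./2).+1) big_mkord.
rewrite (hg lam hlam) -/N sum_parts2.
rewrite (big_ord_widen (N./2).+1
  (fun k => \sum_(l < b.+1) g (two_rows N k) (two_rows N l) lam)) //.
rewrite [RHS]big_mkcond; apply: eq_bigr => k _ /=.
rewrite sum_parts2 (big_ord_widen (N./2).+1 (fun l => g (two_rows N k) (two_rows N l) lam)) //.
have hk := ltn_ord k; rewrite ltnS in hk.
case ka: (k < a.+1)%N; last first.
  rewrite big1 // => l _; rewrite schur_coef_two_rows //.
  by rewrite -ltnS ka mulr0 mul0r.
rewrite [RHS]big_mkcond; apply: eq_bigr => l _ /=.
have hl := ltn_ord l; rewrite ltnS in hl.
rewrite !schur_coef_two_rows // -(ltnS k a) -(ltnS l b) ka mulr1.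
by case: (l < b.+1)%N; rewrite ?mulr1 ?mulr0.
Qed.

Lemma schur_coef_pad4 (lam alpha : seq nat) : (size lam <= 4)%N ->
  schur_coef lam alpha =
  schur_coef [:: part lam 1; part lam 2; part lam 3; part lam 4] alpha.
Proof.
case: lam => [|x1 [|x2 [|x3 [|x4 [|? ?]]]]] // _.
- by rewrite -(schur_coef_rcons0 [:: x1]) -(schur_coef_rcons0 [:: x1; 0]%N)
    -(schur_coef_rcons0 [:: x1; 0; 0]%N).
- by rewrite -(schur_coef_rcons0 [:: x1; x2]) -(schur_coef_rcons0 [:: x1; x2; 0]%N).
- by rewrite -(schur_coef_rcons0 [:: x1; x2; x3]).
Qed.

Lemma schur_sub_coef_pad4 (lam : seq nat) (a1 a2 b1 b2 : nat) : (size lam <= 4)%N ->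
  schur_sub_coef lam a1 a2 b1 b2 =
  schur_sub_coef [:: part lam 1; part lam 2; part lam 3; part lam 4] a1 a2 b1 b2.
Proof.
move=> h; rewrite /schur_sub_coef; do 4![apply: eq_bigr => ? _].
by rewrite -schur_coef_pad4.
Qed.

Lemma partition_parts4 (lam : seq nat) : is_partition lam -> (size lam <= 4)%N ->
  [/\ (part lam 4 <= part lam 3)%N, (part lam 3 <= part lam 2)%N,
      (part lam 2 <= part lam 1)%N
    & sumn lam = (part lam 1 + part lam 2 + part lam 3 + part lam 4)%N].
Proof.
rewrite /is_partition /part /geq.
case: lam => [|x1 [|x2 [|x3 [|x4 [|? ?]]]]] //= h _; split => //; lia.
Qed.

(** The predicate [x.+1 == a] selects degree [a - 1]; for [a = 0] this must match an empty partial
    sum. *)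
Lemma gt_sum_pred0l (l1 l2 l3 l4 : nat) (q : pred nat) :
  gt_sum l1 l2 l3 l4 (fun x => x.+1 == 0)%N q = 0%N.
Proof. by rewrite /gt_sum !pair_big big1 // => p _; rewrite andbF. Qed.

Lemma gt_sum_pred0r (l1 l2 l3 l4 : nat) (p : pred nat) :
  gt_sum l1 l2 l3 l4 p (fun x => x.+1 == 0)%N = 0%N.
Proof. by rewrite /gt_sum !pair_big big1 // => i _; rewrite !andbF. Qed.

Theorem theorem3p5 (g : seq nat -> seq nat -> seq nat -> int)
  (hg : kronecker_spec g) (lam mu nu : seq nat) :
  is_partition lam -> is_partition mu -> is_partition nu ->
  sumn mu = sumn lam -> sumn nu = sumn lam ->
  (size lam <= 4)%N -> (size mu <= 2)%N -> (size nu <= 2)%N ->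
  (part nu 2 <= part mu 2)%N ->
  g mu nu lam <= (atomic_kron mu nu lam)%:Z.
Proof.
move=> plam pmu pnu smu snu zlam zmu znu _.
have [muE ha] := partition_two_rows mu pmu zmu.
have [nuE hb] := partition_two_rows nu pnu znu.
have [h43 h32 h21 sE] := partition_parts4 lam plam zlam.
rewrite smu in muE ha; rewrite snu in nuE hb.
rewrite /atomic_kron {1}muE {1}nuE.
move: (part mu 2) (part nu 2) ha hb => a b ha hb {muE nuE}.
pose gk k l := g (two_rows (sumn lam) k) (two_rows (sumn lam) l) lam.
set l1 := part lam 1 in h21 sE *; set l2 := part lam 2 in h21 h32 sE *.
set l3 := part lam 3 in h32 h43 sE *; set l4 := part lam 4 in h43 sE *.
have S00 i j : (i <= (sumn lam)./2)%N -> (j <= (sumn lam)./2)%N ->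
    (gt_sum l1 l2 l3 l4 (pred1 i) (pred1 j))%:Z
    = \sum_(k < i.+1) \sum_(l < j.+1) gk k l.
  move=> hi hj; rewrite -schur_sub_coef_gt //; [|lia..].
  by rewrite -sE -schur_sub_coef_pad4 //; apply: kronecker_partial_sum.
have S01 i : (i <= (sumn lam)./2)%N ->
    (gt_sum l1 l2 l3 l4 (pred1 i) (fun y => y.+1 == b))%:Z
    = \sum_(k < i.+1) \sum_(l < b) gk k l.
  case: b hb => [|j] hj hi; last exact: (S00 i j hi (ltnW hj)).
  by rewrite gt_sum_pred0r big1 // => k _; rewrite big_ord0.
have S10 (q : pred nat) (j : nat) :
    (forall i, (i <= (sumn lam)./2)%N ->
      (gt_sum l1 l2 l3 l4 (pred1 i) q)%:Z = \sum_(k < i.+1) \sum_(l < j) gk k l) ->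
    (gt_sum l1 l2 l3 l4 (fun x => x.+1 == a) q)%:Z
    = \sum_(k < a) \sum_(l < j) gk k l.
  case: a ha => [|i] hi Hq; last exact: (Hq i (ltnW hi)).
  by rewrite gt_sum_pred0l big_ord0.
have le_a : (a.*2 <= (l1 + l2 + l3 + l4).+1)%N by rewrite -sE; lia.
have E0 := gt_sum_diff l1 l2 l3 l4 a (pred1 b) h43 h32 h21 le_a.
have E1 := gt_sum_diff l1 l2 l3 l4 a (fun y => y.+1 == b) h43 h32 h21 le_a.
have le_hw := leq_trans (hw_sum_step l1 l2 l3 l4 a b)
  (leq_add (leqnn _) (boundary_le_pS l1 l2 l3 l4 a b)).
have F00 := S00 a b ha hb; have F01 := S01 a ha.
have F10 := S10 _ b.+1 (fun i hi => S00 i b hi hb); have F11 := S10 _ b S01.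
rewrite -/(gk a b).
(* Peeling off the row [a], and its last entry for the y-degree [b], leaves the same remainder of
   that row in [G0] and [G1]. *)
have G0 := F00; rewrite big_ord_recr /= [X in _ + X]big_ord_recr /= -F10 in G0.
have G1 := F01; rewrite big_ord_recr /= -F11 in G1.
(* Here [x] is the sum of [gk a l] over [l < b] and [y] is [gk a b]; subtracting the two
   x-differences gives [y = H0 - H1]. *)
have key (A B C D H0 H1 P : nat) (x y : int) : (H0 <= H1 + P)%N ->
    A = (B + H0)%N -> C = (D + H1)%N ->
    A%:Z = B%:Z + (x + y) -> C%:Z = D%:Z + x -> y <= P%:Z by clear; lia.
exact: key le_hw E0 E1 G0 G1.
Qed.
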